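(* Let $\mathbb{K}\in\{\mathbb{R},\mathbb{C}\}$, let $(\Omega,\Sigma,\mu)$ be a positive measure space, let $\bm{\varphi}:\Omega\to\mathbb{K}^n$ be a $\mu$-frame for $\mathbb{K}^n$ and let $S_{\bm{\varphi}}:=S_{\bm{\varphi}}(\mu)$ be the associated frame operator. Then there exist $N\le\dim_{\mathbb{K}}\operatorname{lin}_{\mathbb{K}}\{\bm{\varphi}(x)\bm{\varphi}(x)^\ast: x\in\Omega\}$, points $x_1,\ldots,x_N\in\Omega$ and weights $\mu_1,\ldots,\mu_N>0$ such that $$S_{\bm{\varphi}}=\sum_{j=1}^N\mu_j\,\bm{\varphi}(x_j)\bm{\varphi}(x_j)^\ast.$$
   Context: $\bm{v}^\ast=\overline{\bm{v}}^\top$ and $\operatorname{lin}_{\mathbb{K}}$ is the $\mathbb{K}$-linear span. A measurable function $\bm{\varphi}:\Omega\to\mathbb{K}^n$ is a $\mu$-frame for $\mathbb{K}^n$ if there are constants $0<A\le B<\infty$ with $$A\|f\|^2\le\int_\Omega|\langle f,\bm{\varphi}(x)\rangle|^2\,\mathrm{d}\mu(x)\le B\|f\|^2\quad\text{for all } f\in\mathbb{K}^n.$$ Its frame operator is $S_{\bm{\varphi}}(\mu)=\int_\Omega\bm{\varphi}(x)\bm{\varphi}(x)^\ast\,\mathrm{d}\mu(x)\in\mathbb{K}^{n\times n}$. A positive measure takes values in $[0,\infty]$. *)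

(* Defs.v *)
From HB Require Import structures.
From mathcomp Require Import all_boot all_order all_algebra.
From mathcomp Require Import all_classical all_reals all_analysis.
From mathcomp Require Import complex.

Set Implicit Arguments.
Unset Strict Implicit.
Unset Printing Implicit Defensive.

Import Order.TTheory GRing.Theory Num.Theory.
Import numFieldNormedType.Exports.

Local Open Scope classical_set_scope.
Local Open Scope ring_scope.

(** The choice of [K] in {R, C}: [scalar_type R k] is [R] itself or [R[i]], seen as a
    [numFieldType]. *)
Variant scalar_kind := RealScalars | ComplexScalars.

Definition scalar_type (R : realType) (k : scalar_kind) : numFieldType :=
  match k with
  | RealScalars => R
  | ComplexScalars => R[i]
  end.

Section Scalars.
Variables (R : realType) (k : scalar_kind).

Definition of_real : R -> scalar_type R k :=
  match k return R -> scalar_type R k with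
  | RealScalars => fun a => a
  | ComplexScalars => fun a => (a%:C)%C
  end.

Definition conj : scalar_type R k -> scalar_type R k :=
  match k return scalar_type R k -> scalar_type R k with
  | RealScalars => fun z => z
  | ComplexScalars => fun z : R[i] => conjc z
  end.

(** The norm [`|z|] of [z : R[i]] lives in [R[i]]; [modulus] is real-valued. *)
Definition modulus : scalar_type R k -> R :=
  match k return scalar_type R k -> R with
  | RealScalars => fun z : R => `|z|
  | ComplexScalars => fun z : R[i] => ComplexField.Normc.normc z
  end.

Definition adjoint (m n : nat) (M : 'M[scalar_type R k]_(m, n)) :
    'M[scalar_type R k]_(n, m) :=
  (map_mx conj M)^T.

Definition inner (n : nat) (f g : 'cV[scalar_type R k]_n) : scalar_type R k :=
  \sum_(i < n) f i 0 * conj (g i 0).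

Definition sqnorm (n : nat) (f : 'cV[scalar_type R k]_n) : R :=
  \sum_(i < n) modulus (f i 0) ^+ 2.

Definition outer (n : nat) (v : 'cV[scalar_type R k]_n) : 'M[scalar_type R k]_n :=
  v *m adjoint v.

End Scalars.

Section Frames.
Variables (R : realType) (k : scalar_kind).
Variables (d : measure_display) (Omega : measurableType d).
Variable mu : {measure set Omega -> \bar R}.

Definition scalar_integral : (Omega -> scalar_type R k) -> scalar_type R k :=
  match k return (Omega -> scalar_type R k) -> scalar_type R k with
  | RealScalars => fun g : Omega -> R => Rintegral mu setT g
  | ComplexScalars => fun g : Omega -> R[i] =>
      (Rintegral mu setT (fun x => complex.Re (g x)) +i*
       Rintegral mu setT (fun x => complex.Im (g x)))%C
  end.

Variable n : nat.
Implicit Type phi : Omega -> 'cV[scalar_type R k]_n.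

(** Measurability with respect to the Borel sigma-algebra of [K^n]. *)
Definition borel_measurable phi : Prop :=
  measurable_fun setT
    (phi : Omega -> g_sigma_algebraType (@open 'cV[scalar_type R k]_n)).

Definition is_frame phi : Prop :=
  borel_measurable phi /\
  exists A B : R, [/\ 0 < A, A <= B &
    forall f : 'cV[scalar_type R k]_n,
      ((A * sqnorm f)%:E <= \int[mu]_x ((modulus (inner f (phi x))) ^+ 2)%:E
         <= (B * sqnorm f)%:E)%E].

(** The integral of a matrix-valued function is taken entrywise; for a frame all
    entries are integrable, so the convention that [Rintegral] takes some value
    on non-integrable functions is not used. *)
Definition frame_operator phi : 'M[scalar_type R k]_n :=
  \matrix_(i, j) scalar_integral (fun x => outer (phi x) i j).

End Frames.

Section LinearSpan.
Variables (K : fieldType) (V : vectType K).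
Implicit Type A : set V.

(** [lin A] is the set of all finite linear combinations of elements of the
    possibly infinite set [A]. *)
Definition lin A : set V :=
  [set v | exists2 r : seq V, [set` r] `<=` A & v \in span r].

(** [lin A] as an element of [{vspace V}], so that [\dim] applies; the default
    value [0%VS] is never used, by [mem_linv]. *)
Definition linv A : {vspace V} :=
  xget 0%VS [set U : {vspace V} | [set` U] = lin A].

Lemma mem_linv A : [set` linv A] = lin A.
Proof.
rewrite /linv.
suff ex : exists U : {vspace V}, [set` U] = lin A by exact: (xgetPex 0%VS ex).
pose P m := `[< exists2 r : seq V, [set` r] `<=` A & \dim (span r) = m >].
have exP : exists m, P m.
  by exists (\dim (span ([::] : seq V))); apply/asboolP; exists [::].
have ubP m : P m -> (m <= \dim {: V})%N.
  by move=> /asboolP[r _ <-]; rewrite dimvS// subvf.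
case: (ex_maxnP exP ubP) => m /asboolP[r rA rm] maxm.
exists (span r); apply/seteqP; split => [v vr|v [t tA vt]]; first by exists r.
have rt : (span r <= span (r ++ t))%VS by rewrite span_cat addvSl.
have /eqP -> : (span r == span (r ++ t))%VS.
  rewrite eqEdim rt/= rm; apply: maxm; apply/asboolP; exists (r ++ t) => //.
  move=> x /=; rewrite mem_cat => /orP[xr|xt]; first exact: rA.
  exact: tA.
by rewrite /= span_cat; apply: subvP vt; rewrite addvSr.
Qed.

End LinearSpan.

(* Main.v *)
Require Import Defs.
From HB Require Import structures.
From mathcomp Require Import all_boot all_order all_algebra.
From mathcomp Require Import all_classical all_reals all_analysis.
From mathcomp Require Import complex.
From mathcomp Require Import lra measurable_realfun.

Import Order.TTheory GRing.Theory Num.Theory.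
Import numFieldNormedType.Exports.

Local Open Scope classical_set_scope.
Local Open Scope ring_scope.

Set Implicit Arguments.
Unset Strict Implicit.
Unset Printing Implicit Defensive.

(** The frame operator is an integral, with nonnegative weight [mu], of the matrices
    [outer (phi x)], so one expects it to be a nonnegative combination of finitely
    many of them.  Three facts turn this into a proof.

    First, the integral of an integrable map [v : T -> R^D] lies in the convex cone
    generated by its values, with no closure needed ([Rintegral_conic_hull]).
    Otherwise a nonzero linear form [l] separates it from that cone:
    [l (v x) >= 0] everywhere while the integral of [l o v] is at most [0].  Hence
    [l o v] vanishes almost everywhere; discarding a null set, [v] takes its values in
    the hyperplane [l = 0], one coordinate is determined by the others, and induction
    on [D] concludes.  As the cone need not be closed, the separation theorem needed
    is the algebraic one: a convex cone that is not the whole space lies in a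
    half-space ([proper_cone_halfspace]).

    Second, the theorem of Caratheodory for cones bounds the number of terms by the
    dimension of the space ([conic_caratheodory]).

    Third, these real statements give the dimension over [K] of the span of the
    matrices [outer (phi x)], because all of them are Hermitian: if a basis of the span
    is chosen among them, then the coordinates of a Hermitian matrix in this basis are
    real ([hermitian_coord_real]).  So [x |-> outer (phi x)] is carried by a map
    into [R^D], where [D] is that dimension.  The coordinates are integrable by the
    upper frame inequality applied to the vectors of the standard basis
    ([frame_coord_integrable]). *)

(** * Spans of sets and linear forms *)

Section Spanning.
Variables (K : fieldType) (V : vectType K).

(** A free sequence in [A] of maximal length spans [A]: an element of [A] outside of
    its span could be added to it. *)
Lemma linv_basis (A : set V) :
  exists2 b : seq V, [set` b] `<=` A & basis_of (linv A) b.
Proof.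
pose P m := `[< exists2 r : seq V, [set` r] `<=` A & free r /\ size r = m >].
have exP : exists m, P m.
  by exists 0%N; apply/asboolP; exists [::]; rewrite ?nil_free.
have ubP m : P m -> (m <= \dim {: V})%N.
  move=> /asboolP[r _ [fr <-]].
  by move: fr => /eqP <-; rewrite dimvS// subvf.
case: (ex_maxnP exP ubP) => m /asboolP[b bA [fb sb]] maxm.
exists b => //.
have Ab a : A a -> a \in <<b>>%VS.
  move=> Aa; apply: contrapT => /negP ab.
  have : P m.+1.
    apply/asboolP; exists (a :: b); last by rewrite free_cons ab fb /= sb.
    by move=> x /=; rewrite inE => /orP[/eqP->//|/bA].
  by move=> /maxm; rewrite ltnn.
rewrite /basis_of fb andbT; apply/eqP/vspaceP => x.
have -> : (x \in linv A) = `[< lin A x >].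
  by rewrite -mem_linv; apply/idP/asboolP.
apply/idP/asboolP => [xb|[r rA xr]]; first by exists b.
by apply: subvP xr; apply/span_subvP => y /rA /Ab.
Qed.

Lemma sub_linv (A : set V) a : A a -> a \in linv A.
Proof.
move=> Aa; have : lin A a.
  exists [:: a]; last exact/memv_span1.
  by move=> x /=; rewrite inE => /eqP->.
by rewrite -mem_linv.
Qed.

Lemma cap_vline (U : {vspace V}) e : e \notin U -> (U :&: <[e]> = 0)%VS.
Proof.
move=> eU; apply/eqP; rewrite -subv0; apply/subvP => x.
rewrite memv_cap memv0 => /andP[xU /vlineP[a xE]]; move: xU; rewrite xE.
have [->|a0 aeU] := eqVneq a 0; first by rewrite scale0r.
by case/negP: eU; rewrite -(scalerK a0 e) memvZ.
Qed.

(** The form is the coordinate along [e] of the projection onto the line of [e]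
    parallel to [U]. *)
Lemma vspace_separation (U : {vspace V}) (e : V) : e \notin U ->
  exists2 l : {scalar V}, l e = 1 & forall u, u \in U -> l u = 0.
Proof.
move=> eU.
have e0 : e != 0 by apply: contraNneq eU => ->; rewrite mem0v.
have capeU : (<[e]> :&: U = 0)%VS by rewrite capvC; exact: cap_vline.
pose l : {scalar V} := coord [tuple e] 0 \o daddv_pi <[e]> U.
exists l => [|u uU] /=.
  rewrite daddv_pi_id ?memv_line//.
  by rewrite (@coord_free _ _ _ [tuple e] 0 0) ?seq1_free.
have : daddv_pi <[e]> U u + daddv_pi U <[e]> u = u.
  by rewrite daddv_pi_add// (subvP (addvSr _ _)).
rewrite (@daddv_pi_id _ _ U)// 1?capvC// => /eqP.
by rewrite -subr_eq0 addrK => /eqP ->; rewrite linear0.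
Qed.

End Spanning.

(** * Convex cones *)

Section Cones.
Variables (R : realType) (V : vectType R).
Implicit Types (A C : set V) (p e : V).

Definition is_cone C : Prop :=
  [/\ C 0, forall x y, C x -> C y -> C (x + y) &
      forall a x, 0 <= a -> C x -> C (a *: x)].

Definition conic_hull A : set V :=
  [set p | exists2 s : seq (R * V),
    {in s, forall q, 0 <= q.1 /\ A q.2} & p = \sum_(q <- s) q.1 *: q.2].

Lemma conic_hull_cone A : is_cone (conic_hull A).
Proof.
split.
- by exists [::] => //; rewrite big_nil.
- move=> _ _ [s sA ->] [t tA ->]; exists (s ++ t); last by rewrite big_cat.
  by move=> q; rewrite mem_cat => /orP[/sA|/tA].
- move=> a _ a0 [s sA ->]; exists [seq (a * q.1, q.2) | q <- s].
    by move=> _ /mapP[q /sA[q0 qA] ->]; rewrite mulr_ge0.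
  by rewrite big_map scaler_sumr; apply: eq_bigr => q _; rewrite scalerA.
Qed.

Lemma sub_conic_hull A : A `<=` conic_hull A.
Proof.
move=> x Ax; exists [:: (1, x)]; last by rewrite big_seq1 scale1r.
by move=> q; rewrite inE => /eqP ->; rewrite ler01.
Qed.

Definition conic_rep A p N (x : 'I_N -> V) (w : 'I_N -> R) : Prop :=
  [/\ forall j, A (x j), forall j, 0 <= w j & p = \sum_j w j *: x j].

Lemma conic_rep_drop A p N (x : 'I_N.+1 -> V) w i :
  conic_rep A p x w -> w i = 0 ->
  conic_rep A p (x \o lift i) (w \o lift i).
Proof.
by move=> [Ax w0 ->] wi; split=> [j|j|]//=; rewrite (bigD1_ord i)//= wi scale0r add0r.
Qed.

Lemma conic_hull_rep A p : conic_hull A p ->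
  exists N (x : 'I_N -> V) w, conic_rep A p x w.
Proof.
move=> [s sA ->]; exists (size s), (fun i => (tnth (in_tuple s) i).2).
exists (fun i => (tnth (in_tuple s) i).1).
split => [j|j|]; last by rewrite big_tnth.
- by have /sA[] : tnth (in_tuple s) j \in s by exact: mem_tnth.
- by have /sA[] : tnth (in_tuple s) j \in s by exact: mem_tnth.
Qed.

(** Moving the weights along the relation [k] leaves the sum unchanged; the largest
    step that keeps them nonnegative makes one of them vanish. *)
Lemma conic_rep_reduce A p N (x : 'I_N.+1 -> V) w k :
  conic_rep A p x w -> \sum_j k j *: x j = 0 -> (exists i, 0 < k i) ->
  exists (y : 'I_N -> V) v, conic_rep A p y v.
Proof.
move=> [Ax w0 pE] kx0 [i0 ki0].
case: (@arg_minP _ _ _ i0 (fun i => 0 < k i) (fun i => w i / k i) ki0) => i /= ki imin.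
set t := w i / k i.
have t0 : 0 <= t by rewrite divr_ge0// ltW.
have rep : conic_rep A p x (fun j => w j - t * k j).
  split=> // [j|].
    rewrite subr_ge0; have [kj|kj] := ltP 0 (k j).
      by rewrite -ler_pdivlMr//; exact: imin.
    by apply: le_trans (w0 j); rewrite mulr_ge0_le0.
  rewrite pE; under [RHS]eq_bigr do rewrite scalerBl -scalerA.
  by rewrite sumrB -scaler_sumr kx0 scaler0 subr0.
exists (x \o lift i), ((fun j => w j - t * k j) \o lift i).
by apply: (conic_rep_drop rep); rewrite divfK ?subrr// gt_eqF.
Qed.

(** In a representation with the least number of terms the vectors are linearly
    independent, by [conic_rep_reduce], and no weight vanishes. *)
Lemma conic_caratheodory A p : conic_hull A p ->
  exists N (x : 'I_N -> V) (w : 'I_N -> R),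
    [/\ (N <= \dim {: V})%N, forall j, A (x j), forall j, 0 < w j &
        p = \sum_j w j *: x j].
Proof.
move=> /conic_hull_rep pA.
pose P N := `[< exists (x : 'I_N -> V) w, conic_rep A p x w >].
have exP : exists N, P N.
  by case: pA => N [x [w xw]]; exists N; apply/asboolP; exists x, w.
case: (ex_minnP exP) => N /asboolP[x [w xw]] Nmin.
have [Ax w0 pE] := xw.
exists N, x, w; split=> //.
- pose X := [tuple x i | i < N].
  have XE (i : 'I_N) : X`_i = x i by rewrite -tnth_nth tnth_mktuple.
  have [fX|] := boolP (free X).
    by rewrite -[N](size_tuple X) -(eqP fX) dimvS// subvf.
  move=> /negP fX; exfalso; apply: fX; apply/freeP => k.
  under eq_bigr do rewrite XE.
  move=> kx0; apply: contrapT => /existsNP[i /eqP ki]; clear X XE.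
  case: N => [|N] in x w xw Nmin Ax w0 pE k kx0 i ki *; first by case: i {ki}.
  suff [y [v yv]] : exists (y : 'I_N -> V) v, conic_rep A p y v.
    have /Nmin : P N by apply/asboolP; exists y, v.
    by rewrite ltnn.
  have [kn|kp|k0] := ltgtP (k i) 0.
  + apply: (@conic_rep_reduce _ _ _ x w (fun j => - k j)) => //.
      by under eq_bigr do rewrite scaleNr; rewrite sumrN kx0 oppr0.
    by exists i; rewrite oppr_gt0.
  + by apply: (@conic_rep_reduce _ _ _ x w k) => //; exists i.
  + by rewrite k0 eqxx in ki.
- move=> i; rewrite lt_neqAle w0 andbT eq_sym; apply/eqP => wi.
  case: N => [|N] in x w xw Nmin Ax w0 pE i wi *; first by case: i {wi}.
  have /Nmin : P N.
    by apply/asboolP; do 2 eexists; exact: (conic_rep_drop xw wi).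
  by rewrite ltnn.
Qed.

Lemma cone_sum C I (r : seq I) (F : I -> V) : is_cone C ->
  (forall i, C (F i)) -> C (\sum_(i <- r) F i).
Proof. by move=> [C0 CD _] CF; apply: (big_ind C). Qed.

(** For a convex cone [C] this says, without mentioning a topology, that [e] is an
    interior point. *)
Definition order_unit C e : Prop :=
  forall x, exists2 t, 0 <= t & C (x + t *: e).

(** The sum of a basis contained in [C] is such a point: adding a large multiple of it
    makes all coordinates nonnegative. *)
Lemma cone_order_unit C : is_cone C -> linv C = fullv ->
  exists e, order_unit C e.
Proof.
move=> Cc linC; have [C0 CD CZ] := Cc.
have [b bC] := linv_basis C; rewrite linC => bB.
pose X := in_tuple b.
have CX (i : 'I_(size b)) : C X`_i by apply: bC => /=; rewrite mem_nth.
exists (\sum_(i < size b) X`_i) => x.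
exists (\sum_(i < size b) `|coord X i x|); first exact: sumr_ge0.
rewrite {1}(@coord_basis _ _ _ _ X x bB (memvf x)) scaler_sumr -big_split/=.
apply: cone_sum => // i; rewrite -scalerDl; apply: CZ => //.
rewrite (bigD1 i)//= addrA addr_ge0 ?sumr_ge0//.
by rewrite -lerBlDl sub0r ler_normr lexx orbT.
Qed.

(** An enlargement of [C] that is still proper, as witnessed by [- e], and that contains
    an [n]-dimensional space.  Once that space is a hyperplane, the enlargement is a
    half-space. *)
Definition lineality_cone C e n : Prop :=
  exists (D : set V) (U : {vspace V}),
    [/\ is_cone D, C `<=` D, ~ D (- e), [set` U] `<=` D & \dim U = n].

(** In the plane of [e] and [e'] the cone [D] is proper and has [e] in its interior, so
    the line [e' + t e] leaves it at a finite [s].  The boundary direction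
    [f = e' + s e] may then be added to the lineality space: if [- e] were in [D + R f],
    then a point of the line beyond [s] would lie in [D], or a negative multiple of
    [e] would. *)
Lemma lineality_extend C e (D : set V) (U : {vspace V}) e' :
  is_cone D -> order_unit C e -> C `<=` D -> ~ D (- e) -> [set` U] `<=` D ->
  e' \notin (U + <[e]>)%VS -> lineality_cone C e (\dim U).+1.
Proof.
move=> Dc uC CD De UD e'U; have [D0 DD DZ] := Dc.
have Dneg a : a < 0 -> ~ D (a *: e).
  move=> a0 Dae; apply: De; rewrite -scaleN1r.
  have -> : -1 = (- a^-1) * a :> R by rewrite mulNr mulVf// lt_eqF.
  by rewrite -scalerA; apply: DZ => //; rewrite oppr_ge0 invr_le0 ltW.
pose T := [set t | D (e' + t *: e)].
have [t0 _ Dt0] : exists2 t0, 0 <= t0 & D (- e' + t0 *: e).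
  by have [t t0 Ct] := uC (- e'); exists t => //; exact: CD.
have Tinf : has_inf T.
  split; first by have [t _ Ct] := uC e'; exists t; exact: CD.
  exists (- t0) => t Tt; rewrite leNgt; apply/negP => tt0.
  apply: (Dneg (t + t0)); first by rewrite -ltrBrDr sub0r.
  have -> : (t + t0) *: e = (e' + t *: e) + (- e' + t0 *: e).
    by rewrite addrACA subrr add0r scalerDl.
  exact: DD.
pose s := inf T; pose f := e' + s *: e.
have fU : f \notin U.
  apply: contra e'U => fU; have -> : e' = f + (- s) *: e by rewrite scaleNr addrK.
  by rewrite memv_add// memvZ// memv_line.
pose D' := [set x | exists a, D (x + a *: f)].
exists D', (U + <[f]>)%VS; split.
- split.
  + by exists 0; rewrite scale0r addr0.
  + move=> x y [a Da] [b Db]; exists (a + b).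
    by rewrite scalerDl addrACA; exact: DD.
  + by move=> a x a0 [b Db]; exists (a * b); rewrite -scalerA -scalerDr; exact: DZ.
- by move=> x /CD Dx; exists 0; rewrite scale0r addr0.
- move=> [a]; have [an|ap|->] := ltgtP a 0; last by rewrite scale0r addr0.
  (* If [a < 0], a point of [T] close to [s] gives a negative multiple of [e]. *)
  + have b0 : 0 < - a^-1 by rewrite oppr_gt0 invr_lt0.
    move=> /(DZ _ _ (ltW b0)).
    have [t Tt ts] := inf_adherent b0 Tinf.
    move=> /(DD _ _ Tt); rewrite -/s in ts.
    have -> : e' + t *: e + - a^-1 *: (- e + a *: f) = (t - (s - a^-1)) *: e.
      rewrite scalerDr scalerN scaleNr opprK scalerA mulNr mulVf ?lt_eqF//.
      rewrite scaleN1r opprD [a^-1 *: e + _]addrCA addrACA subrr add0r.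
      by rewrite -scalerBl -scalerDl opprB.
    by apply: Dneg; rewrite subr_lt0.
  (* If [a > 0], then [s - a^-1] is in [T], below its infimum. *)
  + have b0 : 0 < a^-1 by rewrite invr_gt0.
    move=> /(DZ _ _ (ltW b0)).
    have -> : a^-1 *: (- e + a *: f) = e' + (s - a^-1) *: e.
      rewrite scalerDr scalerA mulVf ?gt_eqF// scale1r scalerN addrC -addrA.
      by rewrite -scalerBl.
    move=> /(ge_inf Tinf.2); rewrite -/s.
    by rewrite leNgt ltrBlDr ltrDl b0.
- move=> x /= /memv_addP[u uU [v /vlineP[a ->] ->]].
  by exists (- a); rewrite scaleNr addrK; exact: UD.
- rewrite dimv_disjoint_sum ?dim_vline; last exact: cap_vline.
  rewrite [f == 0](contraNF _ fU) ?addn1// => /eqP ->.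
  exact: mem0v.
Qed.

(** No closedness is assumed.  If [C] does not span, any form vanishing on [C] will do.
    If it does, an enlargement of [C] with a lineality space [U] of maximal dimension
    satisfies [U + R e = V] by [lineality_extend], and the coordinate along [e]
    parallel to [U] is nonnegative on it. *)
Lemma proper_cone_halfspace C : is_cone C -> C <> setT ->
  exists2 l : {scalar V}, (exists x, l x != 0) & forall x, C x -> 0 <= l x.
Proof.
move=> Cc CT.
have [linC|/eqP linC] := pselect (linv C = fullv); last first.
  have /subvPn[e _ eC] : ~~ (fullv <= linv C)%VS.
    by apply: contra linC => linC; rewrite eqEsubv subvf.
  have [l le lC] := vspace_separation eC.
  exists l => [|x Cx]; first by exists e; rewrite le oner_neq0.
  by rewrite lC// sub_linv.
have [e uC] := cone_order_unit Cc linC.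
have Ce : ~ C (- e).
  move=> Ce; apply: CT; apply/seteqP; split=> // x _.
  have [t t0 Cx] := uC x; case: Cc => _ CD CZ.
  by have := CD _ _ Cx (CZ _ _ t0 Ce); rewrite scalerN addrK.
pose P n := `[< lineality_cone C e n >].
have exP : exists n, P n.
  exists 0%N; apply/asboolP; exists C, 0%VS; split=> //; last exact: dimv0.
  by move=> x /=; rewrite memv0 => /eqP ->; case: Cc.
have ubP n : P n -> (n <= \dim {: V})%N.
  by move=> /asboolP[D [U [_ _ _ _ <-]]]; rewrite dimvS// subvf.
case: (ex_maxnP exP ubP) => n /asboolP[D [U [Dc CD De UD dU]]] nmax.
have UeT x : x \in (U + <[e]>)%VS.
  apply: contrapT => /negP xU.
  have /asboolP/nmax := lineality_extend Dc uC CD De UD xU.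
  by rewrite dU ltnn.
have eU : e \notin U.
  by apply/negP => eU; apply: De; apply: UD => /=; rewrite memvN.
have [l le lU] := vspace_separation eU.
exists l => [|x Cx]; first by exists e; rewrite le oner_neq0.
have /memv_addP[u uU [v /vlineP[a ->] xE]] := UeT x.
have -> : l x = a by rewrite xE linearD linearZ/= lU// le add0r mulr1.
rewrite leNgt; apply/negP => a0; apply: De.
have [_ DD DZ] := Dc.
have -> : - e = (- a^-1) *: (x + (- u)).
  by rewrite xE addrC addKr scalerA mulNr mulVf ?scaleN1r// lt_eqF.
apply: DZ; first by rewrite oppr_ge0 invr_le0 ltW.
by apply: DD; [exact: CD | apply: UD; rewrite /= memvN].
Qed.

(** The half-space contains the cone generated by [A] and [- p], which is proper: if it
    contained [p], then a positive multiple of [p] would be in the hull of [A]. *)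
Lemma cone_separation A p : ~ conic_hull A p ->
  exists2 l : {scalar V}, (exists x, l x != 0) &
    l p <= 0 /\ forall x, A x -> 0 <= l x.
Proof.
move=> Ap; have [C0 CD CZ] := conic_hull_cone A.
pose C := [set x | exists2 t, 0 <= t & conic_hull A (x + t *: p)].
have Cc : is_cone C.
  split.
  - by exists 0; rewrite ?scale0r ?addr0.
  - move=> x y [a a0 Ca] [b b0 Cb]; exists (a + b); first exact: addr_ge0.
    by rewrite scalerDl addrACA; exact: CD.
  - move=> a x a0 [b b0 Cb]; exists (a * b); first exact: mulr_ge0.
    by rewrite -scalerA -scalerDr; exact: CZ.
have CT : C <> setT.
  move=> CT; have [t t0] : C p by rewrite CT.
  have t1 : 0 < 1 + t by rewrite ltr_wpDr.
  have t1V : 0 <= (1 + t)^-1 by rewrite invr_ge0 ltW.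
  rewrite -{1}[p]scale1r -scalerDl => /(CZ _ _ t1V).
  by rewrite scalerA mulVf ?gt_eqF// scale1r.
have [l l0 lC] := proper_cone_halfspace Cc CT.
exists l => //; split.
  rewrite -oppr_ge0 -linearN; apply: lC; exists 1 => //.
  by rewrite scale1r addNr.
move=> x Ax; apply: lC; exists 0 => //; rewrite scale0r addr0.
exact: sub_conic_hull.
Qed.

End Cones.

(** * Integrals as conic combinations of values *)

Section RichterTchakaloff.
Variables (R : realType) (d : measure_display) (T : measurableType d).
Variable mu : {measure set T -> \bar R}.

Definition rintegrable (E : set T) (f : T -> R) : Prop :=
  mu.-integrable E (EFin \o f).

Lemma rintegrableD (E : set T) (f g : T -> R) : measurable E ->
  rintegrable E f -> rintegrable E g -> rintegrable E (fun x => f x + g x).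
Proof. by move=> mE If Ig; exact: (integrableD mE If Ig). Qed.

Lemma rintegrable_lincomb (E : set T) (I : Type) (r : seq I) (f : I -> T -> R)
    (c : I -> R) : measurable E -> (forall i, rintegrable E (f i)) ->
  rintegrable E (fun x => \sum_(i <- r) c i * f i x).
Proof.
move=> mE If; rewrite /rintegrable.
have : mu.-integrable E (fun x => \sum_(i <- r) (c i)%:E * (EFin \o f i) x)%E.
  by apply: integrable_sum => // i _; apply: integrableZl => //; exact: If.
apply: eq_integrable => // x _ /=.
by rewrite -sumEFin; apply: eq_bigr => i _; rewrite EFinM.
Qed.

Lemma Rintegral_lincomb (E : set T) (I : Type) (r : seq I) (f : I -> T -> R)
    (c : I -> R) : measurable E -> (forall i, rintegrable E (f i)) ->
  Rintegral mu E (fun x => \sum_(i <- r) c i * f i x) =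
  \sum_(i <- r) c i * Rintegral mu E (f i).
Proof.
move=> mE If; elim: r => [|i r IH].
  under eq_Rintegral do rewrite big_nil.
  by rewrite big_nil Rintegral_cst// mul0r.
under eq_Rintegral do rewrite big_cons.
rewrite big_cons RintegralD//; last exact: rintegrable_lincomb.
  by rewrite RintegralZl ?IH//; exact: If.
have := rintegrable_lincomb [:: i] c mE If.
by rewrite /rintegrable; under eq_fun do rewrite /= big_seq1.
Qed.

(** Such a [g] vanishes almost everywhere on [E].  Removing a null set makes it vanish at
    every point, and changes no integral over [E]. *)
Lemma zero_set_full (E : set T) (g : T -> R) : measurable E ->
  rintegrable E g -> (forall x, E x -> 0 <= g x) -> Rintegral mu E g <= 0 ->
  exists2 E', measurable E' &
    [/\ E' `<=` E, forall x, E' x -> g x = 0 &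
      forall f, rintegrable E f ->
        rintegrable E' f /\ Rintegral mu E' f = Rintegral mu E f].
Proof.
move=> mE Ig g0 g_le0; have mg := measurable_int _ Ig.
have : ae_eq mu E (EFin \o g) (cst 0%E).
  apply/ae_eq_integral_abs => //.
  rewrite (eq_integral (EFin \o g)); last first.
    by move=> x /set_mem Ex /=; rewrite ger0_norm// g0.
  rewrite -(fineK (integrable_fin_num mE Ig)); congr EFin; apply/eqP.
  by rewrite eq_le g_le0/=; exact: Rintegral_ge0.
move=> [N [mN N0 sN]]; exists (E `\` N); first exact: measurableD.
split=> [x []//|x [Ex Nx]|f If].
  by apply: contrapT => gx; apply: Nx; apply: sN => /= /(_ Ex) [].
have EN : E `\` N `<=` E by move=> x [].
have mEN : measurable (E `\` N) by exact: measurableD.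
split; first exact: integrableS If.
by rewrite /Rintegral [in RHS](negligible_integral mN mE If N0).
Qed.

Lemma scalar_rV D (l : {scalar 'rV[R]_D}) (v : 'rV[R]_D) :
  l v = \sum_i l (delta_mx 0 i) * v 0 i.
Proof.
rewrite {1}[v]row_sum_delta linear_sum/=; apply: eq_bigr => i _.
by rewrite linearZ/= mulrC.
Qed.

(** If the integral [p] is not in the cone, a linear form [l] separates it and may be
    assumed to vanish on all values of [v].  A coordinate [i0] with a nonzero
    coefficient in [l] can then be dropped.  The combination [q] that induction yields
    agrees with [p] on the other coordinates, and also on [i0] because
    [l p = l q = 0]. *)
Lemma Rintegral_conic_hull D (E : set T) (v : T -> 'rV[R]_D) : measurable E ->
  (forall i, rintegrable E (fun x => v x 0 i)) ->
  conic_hull (v @` E) (\row_i Rintegral mu E (fun x => v x 0 i)).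
Proof.
elim: D E v => [|D IH] E v mE Iv.
  by rewrite [\row_i _]thinmx0; case: (conic_hull_cone (v @` E)).
set p := \row_i _; apply: contrapT => Np.
have [l [x0 lx0] [lp lv]] := cone_separation Np.
apply: Np.
pose c i := l (delta_mx 0 i).
have [i0 ci0] : exists i, c i != 0.
  apply: contrapT => /forallNP c0; move: lx0; rewrite scalar_rV big1 ?eqxx// => i _.
  by move: (c0 i) => /negP/negPn/eqP; rewrite /c => ->; rewrite mul0r.
pose g x := \sum_i c i * v x 0 i.
have lE x : l (v x) = g x by rewrite scalar_rV.
have Ig : rintegrable E g by exact: rintegrable_lincomb.
have g0 x : E x -> 0 <= g x by move=> Ex; rewrite -lE; apply: lv; exists x.
have lpE : l p = Rintegral mu E g.
  by rewrite Rintegral_lincomb// scalar_rV; apply: eq_bigr => i _; rewrite mxE.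
have g_le0 : Rintegral mu E g <= 0 by rewrite -lpE.
have [E' mE' [E'E gE' IE']] := zero_set_full mE Ig g0 g_le0.
have lp0 : l p = 0.
  by apply/eqP; rewrite eq_le lp lpE Rintegral_ge0.
have /conic_hull_rep[N [x [w [xE' w0 xp]]]] :
    conic_hull ((fun y => col' i0 (v y)) @` E')
      (\row_i Rintegral mu E' (fun y => col' i0 (v y) 0 i)).
  apply: IH => // i; have [+ _] := IE' _ (Iv (lift i0 i)).
  by under [X in _ -> rintegrable _ X]eq_fun do rewrite mxE.
have {xE'} /choice[y yx] : forall j, exists y, E' y /\ col' i0 (v y) = x j.
  by move=> j; have [y] := xE' j; exists y.
pose q := \sum_j w j *: v (y j).
have qE i : q 0 (lift i0 i) = p 0 (lift i0 i).
  move/rowP/(_ i): xp; rewrite !mxE summxE.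
  under eq_Rintegral do rewrite mxE.
  rewrite (IE' _ (Iv (lift i0 i))).2 => ->; rewrite summxE.
  by apply: eq_bigr => j _; rewrite !mxE -(yx j).2 mxE.
have lq0 : l q = 0.
  rewrite linear_sum big1// => j _.
  by rewrite linearZ/= lE gE' ?mulr0//; exact: (yx j).1.
suff -> : p = q.
  have hull := conic_hull_cone (v @` E).
  apply: cone_sum => // j; have [_ _ hullZ] := hull.
  apply: hullZ => //; apply: sub_conic_hull; exists (y j) => //.
  exact/E'E/(yx j).1.
apply/rowP => i; case: (unliftP i0 i) => [{}i ->|->]; first by rewrite qE.
have : l (p - q) = 0 by rewrite linearB lp0 lq0 subrr.
have pqE i' : (p - q) 0 i' = p 0 i' - q 0 i' by rewrite mxE [X in _ + X]mxE.
rewrite scalar_rV (bigD1_ord i0)//= big1 ?addr0 => [|i' _].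
  by move=> /eqP; rewrite mulf_eq0 (negbTE ci0)/= pqE subr_eq0 => /eqP.
by rewrite pqE qE subrr mulr0.
Qed.

End RichterTchakaloff.

(** * Real and imaginary parts of scalars *)

Section Scalars.
Variables (R : realType) (k : scalar_kind).
Local Notation K := (scalar_type R k).

Definition re_part : K -> R :=
  match k return scalar_type R k -> R with
  | RealScalars => fun z => z
  | ComplexScalars => fun z : R[i] => complex.Re z
  end.

Definition im_part : K -> R :=
  match k return scalar_type R k -> R with
  | RealScalars => fun=> 0
  | ComplexScalars => fun z : R[i] => complex.Im z
  end.

End Scalars.
Arguments re_part {R k}.
Arguments im_part {R k}.

Section ScalarTheory.
Variables (R : realType) (k : scalar_kind).
Local Notation K := (scalar_type R k).

Lemma of_real_additive : zmod_morphism (@of_real R k).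
Proof. by case: k => // x y /=; rewrite rmorphB. Qed.

Lemma of_real_multiplicative : monoid_morphism (@of_real R k).
Proof. by case: k; split=> // x y /=; rewrite rmorphM. Qed.

HB.instance Definition _ := GRing.isZmodMorphism.Build R K
  (@of_real R k) of_real_additive.
HB.instance Definition _ := GRing.isMonoidMorphism.Build R K
  (@of_real R k) of_real_multiplicative.

Lemma conj_additive : zmod_morphism (@conj R k).
Proof. by case: k => // x y /=; rewrite rmorphB. Qed.

Lemma conj_multiplicative : monoid_morphism (@conj R k).
Proof. by case: k; split=> //; [exact: (rmorph1 conjc) | exact: (rmorphM conjc)]. Qed.

HB.instance Definition _ := GRing.isZmodMorphism.Build K K
  (@conj R k) conj_additive.
HB.instance Definition _ := GRing.isMonoidMorphism.Build K K
  (@conj R k) conj_multiplicative.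

Lemma re_part_additive : zmod_morphism (@re_part R k).
Proof. by case: k => // -[? ?] [? ?]. Qed.

Lemma im_part_additive : zmod_morphism (@im_part R k).
Proof. by case: k => [x y /=|-[? ?] [? ?]//]; rewrite subrr. Qed.

HB.instance Definition _ := GRing.isZmodMorphism.Build K R
  (@re_part R k) re_part_additive.
HB.instance Definition _ := GRing.isZmodMorphism.Build K R
  (@im_part R k) im_part_additive.

Lemma conjK : involutive (@conj R k).
Proof. by case: k => // -[a b] /=; rewrite opprK. Qed.

Lemma conj_fixed (z : K) : conj z = z -> z = of_real k (re_part z).
Proof.
case: k z => // -[a b] /= [] /eqP; rewrite eq_sym -addr_eq0 -mulr2n mulrn_eq0/=.
by move=> /eqP ->.
Qed.

Lemma scalarP (z w : K) : re_part z = re_part w -> im_part z = im_part w -> z = w.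
Proof. by case: k z w => //= -[a b] [a' b'] /= -> ->. Qed.

Lemma re_of_realM a (z : K) : re_part (of_real k a * z) = a * re_part z.
Proof. by case: k z => // -[x y] /=; rewrite mul0r subr0. Qed.

Lemma im_of_realM a (z : K) : im_part (of_real k a * z) = a * im_part z.
Proof. by case: k z => [z /=|-[x y] /=]; rewrite ?mulr0 ?mul0r ?addr0. Qed.

Lemma re_partM (z w : K) :
  re_part (z * w) = re_part z * re_part w - im_part z * im_part w.
Proof. by case: k z w => [z w /=|-[x y] [x' y'] //]; rewrite mulr0 subr0. Qed.

Lemma im_partM (z w : K) :
  im_part (z * w) = re_part z * im_part w + im_part z * re_part w.
Proof. by case: k z w => [z w /=|-[x y] [x' y'] //]; rewrite mulr0 mul0r addr0. Qed.

Lemma re_conj (z : K) : re_part (conj z) = re_part z.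
Proof. by case: k z => // -[]. Qed.

Lemma im_conj (z : K) : im_part (conj z) = - im_part z.
Proof. by case: k z => [z /=|-[]//]; rewrite oppr0. Qed.

Lemma sqr_modulus (z : K) : modulus z ^+ 2 = re_part z ^+ 2 + im_part z ^+ 2.
Proof.
case: k z => [z /=|-[a b] /=]; first by rewrite real_normK ?num_real// expr0n addr0.
by rewrite sqr_sqrtr// addr_ge0 ?sqr_ge0.
Qed.

Lemma normr_modulus (z : K) : `|z| = of_real k (modulus z).
Proof. by case: k z. Qed.

Lemma of_real_lt (a b : R) : (of_real k a < of_real k b) = (a < b).
Proof. by case: k => //=; rewrite ltcR. Qed.

Lemma le_modulus (a : R) (z : K) :
  a ^+ 2 <= re_part z ^+ 2 + im_part z ^+ 2 -> `|a| <= modulus z.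
Proof.
move=> az; have z0 : 0 <= modulus z by case: k z {az} => //= -[x y]; exact: sqrtr_ge0.
by rewrite -(@ler_pXn2r _ 2)// ?nnegrE// real_normK ?num_real// sqr_modulus.
Qed.

Lemma modulus_dominated_continuous (f : {additive K -> R}) :
  (forall z, `|f z| <= modulus z) -> continuous f.
Proof.
move=> fm z U /nbhs_ballP[e /= e0 eU]; apply/nbhs_ballP.
exists (of_real k e) => /=; first by rewrite -(rmorph0 (of_real k)) of_real_lt.
move=> w; rewrite -ball_normE /= => zw; apply: eU; rewrite -ball_normE/= -raddfB.
by apply: le_lt_trans (fm _) _; rewrite -of_real_lt -normr_modulus.
Qed.

Lemma re_part_continuous : continuous (@re_part R k).
Proof.
by apply: modulus_dominated_continuous => z; apply: le_modulus; rewrite lerDl sqr_ge0.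
Qed.

Lemma im_part_continuous : continuous (@im_part R k).
Proof.
by apply: modulus_dominated_continuous => z; apply: le_modulus; rewrite lerDr sqr_ge0.
Qed.

Lemma outerE n (v : 'cV[K]_n) i j : outer v i j = v i 0 * conj (v j 0).
Proof. by rewrite mxE big_ord1 !mxE. Qed.

Lemma conj_outer n (v : 'cV[K]_n) i j : conj (outer v i j) = outer v j i.
Proof. by rewrite !outerE rmorphM/= conjK mulrC. Qed.

End ScalarTheory.

(** * Integrability of the entries of the frame operator *)

Section FrameIntegrability.
Variables (R : realType) (k : scalar_kind) (n : nat).
Variables (d : measure_display) (Omega : measurableType d).
Variable mu : {measure set Omega -> \bar R}.
Local Notation K := (scalar_type R k).
Variable phi : Omega -> 'cV[K]_n.

Lemma measurable_coord (f : K -> R) i : borel_measurable phi -> continuous f ->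
  measurable_fun setT (fun x => f (phi x i 0)).
Proof.
move=> mphi cf; apply: (measurability _ (RGenOpens.measurableE R)).
move=> _ [_ [a [b ->] <-]].
apply: (mphi measurableT ((fun v : 'cV[K]_n => f (v i 0)) @^-1` `]a, b[%classic)).
apply: sub_sigma_algebra => /=.
apply: open_comp; last exact: interval_open.
by move=> v _; apply: continuous_comp; [exact: coord_continuous | exact: cf].
Qed.

Lemma inner_delta i (v : 'cV[K]_n) : inner (delta_mx i 0) v = conj (v i 0).
Proof.
rewrite /inner (bigD1 i)//= mxE !eqxx mul1r big1 ?addr0// => j ji.
by rewrite mxE (negbTE ji) mul0r.
Qed.

Hypothesis hphi : is_frame mu phi.

(** The upper frame inequality for the [i]-th vector of the standard basis. *)
Lemma frame_coord_integrable i :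
  rintegrable mu setT (fun x => modulus (phi x i 0) ^+ 2).
Proof.
have [mphi [A [B [_ _ hAB]]]] := hphi.
have /andP[_ hB] := hAB (delta_mx i 0).
apply/integrableP; split.
  apply/measurable_EFinP.
  under eq_fun do rewrite sqr_modulus.
  apply: measurable_funD; apply: measurable_funX; apply: measurable_coord => //.
    exact: re_part_continuous.
  exact: im_part_continuous.
apply: le_lt_trans (ltry (B * sqnorm (delta_mx i 0))).
apply: le_trans hB.
rewrite le_eqVlt; apply/orP; left; apply/eqP; apply: eq_integral => x _ /=.
rewrite inner_delta !sqr_modulus re_conj im_conj sqrrN.
by rewrite ger0_norm// addr_ge0 ?sqr_ge0.
Qed.

Lemma cross_term_le (a b c e : R) :
  `|a * c + b * e| <= (a ^+ 2 + b ^+ 2) + (c ^+ 2 + e ^+ 2).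
Proof.
have [ac0 be0] := (sqr_ge0 (a + c), sqr_ge0 (b + e)).
have [ac1 be1] := (sqr_ge0 (a - c), sqr_ge0 (b - e)).
have [[a0 b0] [c0 e0]] := ((sqr_ge0 a, sqr_ge0 b), (sqr_ge0 c, sqr_ge0 e)).
by rewrite ler_norml; apply/andP; split; lra.
Qed.

(** Products of square-integrable functions.  The real and the imaginary part of an
    entry of [outer (phi x)] both have this form, with [f], [g] and [h], [l] the real and
    imaginary parts in some order and up to sign. *)
Lemma rintegrable_cross (f g h l : K -> R) i j :
  continuous f -> continuous g -> continuous h -> continuous l ->
  (forall z, f z ^+ 2 + g z ^+ 2 = modulus z ^+ 2) ->
  (forall z, h z ^+ 2 + l z ^+ 2 = modulus z ^+ 2) ->
  rintegrable mu setT (fun x =>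
    f (phi x i 0) * h (phi x j 0) + g (phi x i 0) * l (phi x j 0)).
Proof.
move=> cf cg ch cl fg hl; have [mphi _] := hphi.
apply: (@le_integrable _ _ _ _ _ measurableT _
  (EFin \o (fun x => modulus (phi x i 0) ^+ 2 + modulus (phi x j 0) ^+ 2))).
- apply/measurable_EFinP; apply: measurable_funD; apply: measurable_funM;
    exact: measurable_coord.
- move=> x _ /=; rewrite lee_fin -fg -hl.
  apply: le_trans (cross_term_le _ _ _ _) _.
  by rewrite ger0_norm// !addr_ge0 ?sqr_ge0.
- exact: (integrableD measurableT (frame_coord_integrable i)
            (frame_coord_integrable j)).
Qed.

Lemma re_outer_integrable i j :
  rintegrable mu setT (fun x => re_part (outer (phi x) i j)).
Proof.
under [X in rintegrable _ _ X]eq_fun do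
  rewrite outerE re_partM re_conj im_conj mulrN opprK.
apply: rintegrable_cross; first [exact: re_part_continuous |
  exact: im_part_continuous | by move=> z; rewrite sqr_modulus].
Qed.

Lemma im_outer_integrable i j :
  rintegrable mu setT (fun x => im_part (outer (phi x) i j)).
Proof.
under [X in rintegrable _ _ X]eq_fun do
  rewrite outerE im_partM re_conj im_conj mulrN addrC -mulrN.
apply: (@rintegrable_cross im_part re_part re_part (fun z => - im_part z)) => //;
  try first [exact: re_part_continuous | exact: im_part_continuous].
- by move=> z; apply: continuousN; exact: im_part_continuous.
- by move=> z; rewrite sqr_modulus addrC.
- by move=> z; rewrite sqr_modulus sqrrN.
Qed.

End FrameIntegrability.

(** * Real coordinates of Hermitian matrices *)

Section HermitianCoordinates.
Variables (R : realType) (k : scalar_kind) (n : nat).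
Local Notation K := (scalar_type R k).

Definition hermitian (M : 'M[K]_n) : Prop := forall i j, conj (M i j) = M j i.

(** Conjugating the coordinates of [M] gives those of its adjoint, which is [M]
    itself. *)
Lemma hermitian_coord_real m (X : m.-tuple 'M[K]_n) (M : 'M[K]_n) i :
  free X -> (forall j : 'I_m, hermitian X`_j) -> hermitian M -> M \in <<X>>%VS ->
  coord X i M = of_real k (re_part (coord X i M)).
Proof.
move=> fX hX hM MX; apply: conj_fixed.
suff {2}-> : M = \sum_(j < m) conj (coord X j M) *: X`_j by rewrite coord_sum_free.
apply/matrixP => a b; rewrite -hM {1}(coord_span MX) !summxE rmorph_sum/=.
by apply: eq_bigr => j _; rewrite !mxE rmorphM/= hX.
Qed.

End HermitianCoordinates.

(** * The frame operator *)

Section FrameOperator.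
Variables (R : realType) (k : scalar_kind) (n : nat).
Variables (d : measure_display) (Omega : measurableType d).
Variable mu : {measure set Omega -> \bar R}.
Local Notation K := (scalar_type R k).
Variable phi : Omega -> 'cV[K]_n.

Lemma re_scalar_integral (g : Omega -> K) :
  re_part (scalar_integral mu g) = Rintegral mu setT (fun x => re_part (g x)).
Proof. by case: k g. Qed.

Lemma im_scalar_integral (g : Omega -> K) :
  im_part (scalar_integral mu g) = Rintegral mu setT (fun x => im_part (g x)).
Proof. by case: k g => //= g; rewrite Rintegral_cst// mul0r. Qed.

Lemma scalar_integral_lincomb m (c : 'I_m -> Omega -> R) (z : 'I_m -> K) :
  (forall i, rintegrable mu setT (c i)) ->
  scalar_integral mu (fun x => \sum_i of_real k (c i x) * z i) =
  \sum_i of_real k (Rintegral mu setT (c i)) * z i.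
Proof.
move=> Ic; apply: scalarP.
  rewrite re_scalar_integral raddf_sum/=.
  under eq_Rintegral do
    [rewrite raddf_sum/=; under eq_bigr do rewrite re_of_realM mulrC].
  rewrite Rintegral_lincomb//; apply: eq_bigr => i _.
  by rewrite re_of_realM mulrC.
rewrite im_scalar_integral raddf_sum/=.
under eq_Rintegral do
    [rewrite raddf_sum/=; under eq_bigr do rewrite im_of_realM mulrC].
rewrite Rintegral_lincomb//; apply: eq_bigr => i _.
by rewrite im_of_realM mulrC.
Qed.

Lemma re_functional_outer_integrable (L : {scalar 'M[K]_n}) :
  is_frame mu phi -> rintegrable mu setT (fun x => re_part (L (outer (phi x)))).
Proof.
move=> hphi; pose l (p : 'I_n * 'I_n) := L (delta_mx p.1 p.2).
have -> : (fun x => re_part (L (outer (phi x)))) = (fun x =>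
    \sum_p re_part (l p) * re_part (outer (phi x) p.1 p.2) +
    \sum_p - im_part (l p) * im_part (outer (phi x) p.1 p.2)).
  apply/funext => x; rewrite -big_split/= [X in L X]matrix_sum_delta pair_bigA/=.
  rewrite linear_sum raddf_sum/=; apply: eq_bigr => p _.
  by rewrite linearZ/= mulrC re_partM mulNr.
apply: rintegrableD => //; apply: rintegrable_lincomb => // p.
  exact: re_outer_integrable.
exact: im_outer_integrable.
Qed.

End FrameOperator.

Theorem corollary6p10 (R : realType) (k : scalar_kind) (n : nat)
    (d : measure_display) (Omega : measurableType d)
    (mu : {measure set Omega -> \bar R})
    (phi : Omega -> 'cV[scalar_type R k]_n) (hphi : is_frame mu phi) :
  exists (N : nat) (x : 'I_N -> Omega) (w : 'I_N -> R),
    [/\ (N <= \dim (linv (range (fun y : Omega => outer (phi y)))))%N,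
        (forall j, 0 < w j) &
        frame_operator mu phi = \sum_(j < N) of_real k (w j) *: outer (phi (x j))].
Proof.
set A := range _.
have [b bA bB] := linv_basis A.
pose X := in_tuple b.
have hX (j : 'I_(size b)) : hermitian X`_j.
  have [y _ <-] : A X`_j by apply: bA => /=; rewrite mem_nth.
  exact: conj_outer.
(* The coordinates in the basis [b] are real, so their real parts determine them. *)
pose c x : 'rV[R]_(size b) := \row_i re_part (coord X i (outer (phi x))).
have outerX x : outer (phi x) = \sum_i of_real k (c x 0 i) *: X`_i.
  have oX : outer (phi x) \in <<X>>%VS.
    by rewrite (span_basis bB); apply: sub_linv; exists x.
  rewrite {1}(coord_span oX); apply: eq_bigr => i _; rewrite mxE.
  by rewrite {1}hermitian_coord_real ?(basis_free bB)//; exact: conj_outer.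
have Ic i : rintegrable mu setT (fun x => c x 0 i).
  have := re_functional_outer_integrable (coord X i) hphi.
  by under [X in _ -> rintegrable _ _ X]eq_fun do rewrite mxE.
have [N [v [w [Nb cv w0 cE]]]] :=
  conic_caratheodory (Rintegral_conic_hull measurableT Ic).
have {cv} /choice[x xv] : forall j, exists x, c x = v j.
  by move=> j; have [x _] := cv j; exists x.
exists N, x, w; split=> //.
  by rewrite (@size_basis _ _ _ _ X bB) (leq_trans Nb)// dimvf/= /dim/= mul1n.
apply/matrixP => a e; rewrite mxE.
have -> : (fun y => outer (phi y) a e) =
    (fun y => \sum_i of_real k (c y 0 i) * X`_i a e).
  apply/funext => y; rewrite {1}outerX summxE.
  by apply: eq_bigr => i _; rewrite mxE.
rewrite scalar_integral_lincomb// summxE.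
under [RHS]eq_bigr => j _.
  rewrite mxE outerX summxE mulr_sumr.
  under eq_bigr do rewrite mxE mulrA -rmorphM/= xv.
  over.
rewrite exchange_big/=; apply: eq_bigr => i _.
rewrite -mulr_suml -rmorph_sum/=; congr (of_real k _ * _).
by move/rowP/(_ i): cE; rewrite mxE summxE => ->; apply: eq_bigr => j _; rewrite mxE.
Qed.
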